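(* Let $\{S_n, n\ge 1\}$ be a sequence of integer-valued random variables, and let $a_n\in\mathbb{R}$ and $b_n>0$ be real numbers with $b_n\to\infty$ such that the distributions of $(S_n-a_n)/b_n$ converge weakly to an absolutely continuous distribution with distribution function $G$ and density $g$, where $g$ is uniformly continuous on $\mathbb{R}$. Put $$\varepsilon_n:=\sup_{x\in\mathbb{R}}\Big|\mathbb{P}\Big\{\frac{S_n-a_n}{b_n}<x\Big\}-G(x)\Big|,$$ so that $\varepsilon_n\to 0$. Let $(v_n)_{n\ge 1}$ be a sequence of positive integers such that $v_n=o(b_n)$. Then the following assertions are equivalent. (A') As $n\to\infty$, $$\sup_{\substack{m,k\in\mathbb{Z}\\ |m-k|\le v_n}}\Big|\mathbb{P}\{S_n=m\}-\mathbb{P}\{S_n=k\}\Big| = o\Big(\frac{1}{b_n}\Big)+\frac{1}{v_n}\,\mathcal{O}(\varepsilon_n).$$ (B') As $n\to\infty$, $$\sup_{m\in\mathbb{Z}}\Big|\mathbb{P}\{S_n=m\}-\frac{1}{b_n}\,g\Big(\frac{m-a_n}{b_n}\Big)\Big| = o\Big(\frac{1}{b_n}\Big)+\frac{1}{v_n}\,\mathcal{O}(\varepsilon_n).$$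
   Context: No independence or other structural assumption on the $S_n$ is made. For a sequence of nonnegative quantities $q_n$, the statement $q_n=o(1/b_n)+\frac{1}{v_n}\mathcal{O}(\varepsilon_n)$ as $n\to\infty$ means: there exist a constant $C\ge 0$ and a sequence $\delta_n\ge 0$ with $\delta_n\to 0$ such that $q_n\le \delta_n/b_n + C\,\varepsilon_n/v_n$ for all sufficiently large $n$. *)

(* Defs.v *)
From HB Require Import structures.
From mathcomp Require Import all_boot all_order all_algebra.
From mathcomp Require Import all_classical all_reals all_analysis.
From mathcomp Require Import measurable_realfun.

Set Implicit Arguments.
Unset Strict Implicit.
Unset Printing Implicit Defensive.

Import Order.TTheory GRing.Theory Num.Theory.
Import numFieldNormedType.Exports.

Local Open Scope classical_set_scope.
Local Open Scope ring_scope.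

Section normalized_random_variable.
Context d (T : measurableType d) (R : realType) (P : probability T R).

Definition normalized (X : {RV P >-> R}) (a b : R) : T -> R :=
  fun w => (X w - a) / b.

Lemma measurable_normalized (X : {RV P >-> R}) (a b : R) :
  measurable_fun [set: T] (normalized X a b).
Proof.
apply: measurable_funM; last exact: measurable_cst.
by apply: measurable_funB; [exact: measurable_funPT|exact: measurable_cst].
Qed.

HB.instance Definition _ (X : {RV P >-> R}) (a b : R) :=
  isMeasurableFun.Build _ _ _ _ (normalized X a b)
    (measurable_normalized X a b).

End normalized_random_variable.

Definition weak_cvg (R : realType)
    (Qn : nat -> probability R R)
    (Q : probability R R) : Prop :=
  forall f : R -> R, continuous f -> (exists M, forall x, `|f x| <= M) ->
    (\int[Qn n]_x (f x)%:E)%E @[n --> \oo] --> (\int[Q]_x (f x)%:E)%E.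

Definition has_density (R : realType)
    (Q : probability R R) (g : R -> R) : Prop :=
  [/\ measurable_fun [set: R] g, (forall x, 0 <= g x) &
      forall A : set R, measurable A ->
        Q A = (\int[lebesgue_measure]_(x in A) (g x)%:E)%E].

(* The strict inequality [X < x] is intended; [G] is given by the library's
   convention [`]-oo, x]], which makes no difference for a continuous [G]. *)
Definition unif_dist (d : measure_display) (T : measurableType d)
    (R : realType) (P : probability T R) (X : T -> R) (G : R -> R) : R :=
  sup [set `|fine (P [set w | X w < x]) - G x| | x in [set: R]].

(* q_n = o(1 / b_n) + (1 / v_n) O(eps_n), for nonnegative q_n *)
Definition o_plus_bigO (R : realType) (b : nat -> R) (v : nat -> nat)
    (eps q : nat -> R) : Prop :=
  exists (C : R) (delta : nat -> R),
    [/\ 0 <= C, (forall n, 0 <= delta n), delta n @[n --> \oo] --> 0 &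
        \forall n \near \oo, q n <= delta n / b n + C * eps n / (v n)%:R].

(* Main.v *)
Require Import Defs.
From mathcomp Require Import all_boot all_order all_algebra.
From mathcomp Require Import all_classical all_reals all_analysis.
From mathcomp Require Import measurable_realfun ring lra.

Set Implicit Arguments.
Unset Strict Implicit.
Unset Printing Implicit Defensive.

Import Order.TTheory GRing.Theory Num.Theory.
Import numFieldNormedType.Exports.

Local Open Scope classical_set_scope.
Local Open Scope ring_scope.

(** Write [p m] for the probability that [S_n = m] and [x_m = (m - a_n) / b_n].
    The [v_n] consecutive weights [p m, ..., p (m + v_n - 1)] add up to the
    probability that [m <= S_n < m + v_n], an increment of the distribution
    function of the normalized variable. Replacing both of its values by those
    of [G] costs at most [2 eps_n], and the increment of [G] is the integral of
    [g] over an interval of length [v_n / b_n] starting at [x_m]. With [om_n]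
    the oscillation of [g] at scale [v_n / b_n], this gives
    [|p m + ... + p (m + v_n - 1) - v_n / b_n * g x_m|
       <= 2 eps_n + v_n / b_n * om_n]
    (lemma [pmf_window_approx]). Since [v_n = o(b_n)] and [g] is uniformly
    continuous, [om_n] tends to 0 (lemma [modulus_cvg0]).

    If nearby weights differ by at most [A_n], the sum on the left is within
    [v_n A_n] of [v_n * p m]; dividing by [v_n] yields
    [|p m - g x_m / b_n| <= A_n + om_n / b_n + 2 eps_n / v_n].
    Conversely, if [B_n] bounds the local error, then for [|m - k| <= v_n] the
    triangle inequality through [g x_m / b_n] and [g x_k / b_n] yields
    [|p m - p k| <= 2 B_n + om_n / b_n].
    Both inequalities preserve the form [o(1 / b_n) + O(eps_n) / v_n]
    (lemma [o_plus_bigO_le]).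

    The suprema [B_n] and [om_n] bound the quantities over which they are taken
    because a uniformly continuous density is bounded
    (lemma [unif_continuous_density_bounded]). *)

(** * Distributions with a uniformly continuous density *)

Lemma unif_continuous_epsilon_delta (R : realType) (g : R -> R) :
  unif_continuous g -> forall e : R, 0 < e ->
  exists2 h : R, 0 < h & forall x y, `|x - y| < h -> `|g x - g y| < e.
Proof.
move=> gu e e0.
have /gu := entourage_ball R (PosNum e0).
rewrite -entourage_ballE => -[h /= h0 H].
by exists h => // x y xy; exact: (H (x, y)).
Qed.

Section density.
Context (R : realType) (Q : probability R R) (G g : R -> R).
Hypotheses (G_df : forall x, (G x)%:E = Q `]-oo, x]%classic)
           (g_density : has_density Q g).

Lemma cdf_increment (x y : R) : x <= y ->
  (G y - G x)%:E = (\int[lebesgue_measure]_(z in `]x, y]) (g z)%:E)%E.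
Proof.
move=> xy; have [mg g0 gE] := g_density.
have xy0 : `]-oo, x] `&` `]x, y] = set0 :> set R.
  apply/seteqP; split=> // z [] /=; rewrite !in_itv/= => zx /andP[].
  by rewrite ltNge zx.
have : Q `]-oo, y]%classic = ((G x)%:E + Q `]x, y]%classic)%E.
  by rewrite G_df -measureU// -itv_bndbnd_setU// bnd_simp.
by rewrite -G_df -gE// EFinB => ->; rewrite addeAC -EFinB subrr add0e.
Qed.

(** An increment of the distribution function is an integral of [g], and an
    integral lies between the length times the infimum and the length times
    the supremum. *)
Lemma cdf_increment_approx (x y c w : R) : x <= y ->
  (forall z, x <= z <= y -> `|g z - c| <= w) ->
  `|G y - G x - (y - x) * c| <= (y - x) * w.
Proof.
move=> xy gw; have [mg g0 gE] := g_density.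
have lxy : lebesgue_measure (`]x, y]%classic : set R) = (y - x)%:E.
  rewrite lebesgue_measure_itv/= lte_fin.
  case: ltP => // yx; suff -> : x = y by rewrite subrr.
  by apply/le_anti; rewrite xy.
have mxy : measurable (`]x, y]%classic : set R) by [].
have mg' : measurable_fun `]x, y] (EFin \o g).
  by apply/measurable_EFinP; exact: measurable_funTS.
have cstE (k : R) : (\int[lebesgue_measure]_(z in `]x, y]) (cst k%:E) z)%E =
    (k * (y - x))%:E 
    by rewrite integral_cst// EFinM; congr (_ * _)%E; exact: lxy.
have bnd z : z \in `]x, y] -> c - w <= g z <= c + w.
  rewrite in_itv/= => /andP[xz zy].
  by have := gw z; rewrite (ltW xz) zy => /(_ isT); rewrite ler_norml; lra.
have up : G y - G x <= (c + w) * (y - x).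
  rewrite -lee_fin cdf_increment// -cstE; apply: ge0_le_integral => //=.
  - by move=> z _; rewrite lee_fin.
  - by move=> z /bnd /andP[_]; rewrite lee_fin.
(* Monotonicity of the integral is used for nonnegative functions, so the
   case of a negative lower bound is treated apart. *)
have lo : (c - w) * (y - x) <= G y - G x.
  have [cw0|cw0] := leP 0 (c - w).
    rewrite -lee_fin cdf_increment// -cstE; apply: ge0_le_integral => //=.
    by move=> z /bnd /andP[+ _]; rewrite lee_fin.
  apply: (@le_trans _ _ 0); first by rewrite mulr_le0_ge0 ?(ltW cw0) ?subr_ge0.
  rewrite -lee_fin cdf_increment//; apply: integral_ge0 => z _.
  by rewrite lee_fin.
rewrite ler_norml; lra.
Qed.

Lemma cdf_bounds x : 0 <= G x <= 1.
Proof. by rewrite -!lee_fin !G_df measure_ge0/= probability_le1. Qed.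

(** If [g] were huge at [x], uniform continuity would keep it huge on an
    interval around [x] of fixed length, whose mass would exceed 1. *)
Lemma unif_continuous_density_bounded : unif_continuous g ->
  exists M : R, forall x, `|g x| <= M.
Proof.
move=> /unif_continuous_epsilon_delta /(_ 1 ltr01) [h h0 gh].
exists (1 + (h / 2)^-1) => x; have [_ g0 _] := g_density.
rewrite ger0_norm//.
have h20 : 0 < h / 2 by lra.
have xx : x <= x + h / 2 by lra.
have gx z : x <= z <= x + h / 2 -> `|g z - g x| <= 1.
  move=> /andP[xz zx]; apply/ltW/gh.
  by rewrite ger0_norm; lra.
have := cdf_increment_approx xx gx.
rewrite [x + _ - x]addrAC subrr add0r mulr1 ler_norml.
have /andP[? ?] := cdf_bounds x; have /andP[? ?] := cdf_bounds (x + h / 2).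
move=> /andP[H _]; rewrite -lerBlDl -(ler_pM2l h20) divff ?gt_eqF//; lra.
Qed.

End density.

(** * Modulus of continuity *)

(** For [h < 0] the set is empty and its supremum is 0, so that the modulus is
    nonnegative for every [h]. *)
Definition modulus (R : realType) (g : R -> R) (h : R) : R :=
  sup [set q | exists x y : R, `|x - y| <= h /\ q = `|g x - g y|].

Lemma le_modulus (R : realType) (g : R -> R) (M h x y : R) :
  (forall x, `|g x| <= M) -> `|x - y| <= h -> `|g x - g y| <= modulus g h.
Proof.
move=> gM xy; apply: ub_le_sup; last by exists x, y.
exists (M + M) => _ [u [t [_ ->]]].
by rewrite (le_trans (ler_normB _ _))// lerD.
Qed.

Lemma modulus_ge0 (R : realType) (g : R -> R) (h : R) : 0 <= modulus g h.
Proof.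
rewrite /modulus; set E := (X in sup X).
have [sE|?] := pselect (has_sup E); last by rewrite sup_out.
have [[q Eq] ubE] := sE; have [x [y [_ qE]]] := Eq.
by apply: le_trans (ub_le_sup ubE Eq); rewrite qE.
Qed.

Lemma modulus_cvg0 (R : realType) (g : R -> R) (h : nat -> R) :
  unif_continuous g -> h n @[n --> \oo] --> 0 ->
  modulus g (h n) @[n --> \oo] --> 0.
Proof.
move=> /unif_continuous_epsilon_delta gu /cvgr0_norm_lt h0.
apply/cvgr0Pnorm_le => e e0; have [r r0 gr] := gu e e0.
near=> n.
have hr : h n < r by apply: le_lt_trans (ler_norm _) _; near: n; exact: h0.
rewrite ger0_norm ?modulus_ge0//.
rewrite /modulus; set E := (X in sup X).
have [->|/set0P E0] := eqVneq E set0; first by rewrite sup0 ltW.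
apply: ge_sup => // _ [x [y [xy ->]]].
by apply: ltW; apply: gr; exact: le_lt_trans hr.
Unshelve. all: by end_near. Qed.

(** * Integer-valued random variables *)
Section integer_valued.
Context (d : measure_display) (T : measurableType d) (R : realType)
  (P : probability T R) (X : {RV P >-> R}).

Lemma measurable_lt (f : T -> R) x :
  measurable_fun [set: T] f -> measurable [set w | f w < x].
Proof.
move=> mf; rewrite -[[set w | _]]setTI.
have -> : [set w | f w < x] = f @^-1` `]-oo, x[%classic.
  by apply/seteqP; split=> w /=; rewrite in_itv.
exact: mf.
Qed.

Lemma pmf_bounds x : 0 <= pmf X x <= 1.
Proof.
by rewrite pmf_ge0/= -lee_fin fineK ?fin_num_measure ?probability_le1//.
Qed.

Hypothesis X_int : forall w, X w \is a Num.int.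

(** A variable with integer values satisfies [X < m + k + 1] exactly when
    [X < m + k] or [X = m + k], so the sum telescopes. *)
Lemma pmf_window (m : int) (k : nat) :
  \sum_(j < k) pmf X (m + j%:Z)%:~R =
  fine (P [set w | X w < (m + k%:Z)%:~R]) - fine (P [set w | X w < m%:~R]).
Proof.
elim: k => [|k IHk]; first by rewrite big_ord0 addr0 subrr.
rewrite big_ord_recr/= IHk.
have -> : [set w | X w < (m + k.+1%:Z)%:~R] =
    [set w | X w < (m + k%:Z)%:~R] `|` X @^-1` [set (m + k%:Z)%:~R].
  apply/seteqP; split=> w /=; have /intrP[i ->] := X_int w.
    rewrite !ltr_int -addn1 PoszD addrA ltzD1 le_eqVlt.
    by move=> /predU1P[->|]; [right|left].
  rewrite !ltr_int -addn1 PoszD addrA ltzD1 le_eqVlt => -[->|/intr_inj ->].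
    by rewrite orbT.
  by rewrite eqxx.
rewrite measureU//; first 1 last.
- exact: measurable_lt.
- by apply/seteqP; split=> // w /= [] /[swap] ->; rewrite ltxx.
rewrite fineD ?fin_num_measure//; first by rewrite /pmf; ring.
exact: measurable_lt.
Qed.

Context (G : R -> R) (a b : R).
Hypotheses (G01 : forall x, 0 <= G x <= 1) (b_gt0 : 0 < b).

(** Values in [0, 1] make the set of deviations bounded, so that its supremum
    is an upper bound. *)
Lemma unif_dist_ge x :
  `|fine (P [set w | normalized X a b w < x]) - G x| <=
  unif_dist P (normalized X a b) G.
Proof.
apply: ub_le_sup; last by exists x.
exists 1 => _ [y _ <-]; have /andP[G0 G1] := G01 y.
have mA : measurable [set w | normalized X a b w < y].
  exact/measurable_lt/measurable_normalized.
have : 0 <= fine (P [set w | normalized X a b w < y]) by exact: fine_ge0.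
have : fine (P [set w | normalized X a b w < y]) <= 1.
  by rewrite -lee_fin fineK ?fin_num_measure ?probability_le1.
by rewrite ler_norml; lra.
Qed.

Lemma unif_dist_ge_pmf x :
  `|fine (P [set w | X w < x]) - G ((x - a) / b)| <=
  unif_dist P (normalized X a b) G.
Proof.
have := unif_dist_ge ((x - a) / b).
have -> // : [set w | normalized X a b w < (x - a) / b] = [set w | X w < x].
by apply/seteqP; split=> w /=; rewrite /normalized ltr_pM2r ?invr_gt0// ltrD2r.
Qed.

End integer_valued.

(** The heart of the proof: the mass of a window of [k] consecutive integers is
    computed exactly from the distribution function of [X], then from [G] with
    an error [unif_dist] at each end, and finally from the density. *)
Lemma pmf_window_approx d (T : measurableType d) (R : realType)
    (P : probability T R) (X : {RV P >-> R}) (Q : probability R R)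
    (G g : R -> R) (a b w : R) (k : nat) (m : int) :
  (forall w, X w \is a Num.int) ->
  (forall x, (G x)%:E = Q `]-oo, x]%classic) -> has_density Q g -> 0 < b ->
  (forall x y, `|x - y| <= k%:R / b -> `|g x - g y| <= w) ->
  `|\sum_(j < k) pmf X (m + j%:Z)%:~R - k%:R / b * g ((m%:~R - a) / b)| <=
  2 * unif_dist P (normalized X a b) G + k%:R / b * w.
Proof.
move=> X_int G_df g_density b_gt0 gw; rewrite pmf_window//.
have kb : 0 <= k%:R / b by rewrite divr_ge0// ltW.
set x := (m%:~R - a) / b; set y := ((m + k%:Z)%:~R - a) / b.
have yxE : y - x = k%:R / b.
  by rewrite /y /x -mulrBl intrD; congr (_ / _); ring.
have xy : x <= y by rewrite -subr_ge0 yxE.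
have := cdf_increment_approx G_df g_density xy (c := g x) (w := w).
have G01 := cdf_bounds G_df.
have := unif_dist_ge_pmf X a G01 b_gt0 m%:~R.
have := unif_dist_ge_pmf X a G01 b_gt0 (m + k%:Z)%:~R.
rewrite -/x -/y yxE !ler_norml => H1 H2 H3.
suff /H3 : forall z, x <= z <= y -> `|g z - g x| <= w by lra.
by move=> z /andP[xz zy]; apply: gw; rewrite ger0_norm; lra.
Qed.

(** * Transfer of asymptotic bounds *)

Lemma dist_natmul_sum (R : realDomainType) (k : nat) (c A : R) (F : 'I_k -> R) :
  (forall j, `|c - F j| <= A) -> `|k%:R * c - \sum_(j < k) F j| <= k%:R * A.
Proof.
move=> FA; have natmul_sum (x : R) : k%:R * x = \sum_(j < k) x.
  by rewrite sumr_const card_ord mulr_natl.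
rewrite !natmul_sum -sumrB; apply: le_trans (ler_norm_sum _ _ _) _.
exact: ler_sum.
Qed.

(** The form [o(1 / b_n) + O(eps_n) / v_n] is stable under multiplication by a
    constant and addition of terms of the two allowed kinds. *)
Lemma o_plus_bigO_le (R : realType) (b : nat -> R) (v : nat -> nat)
    (eps q q' om : nat -> R) (k c : R) : 0 <= k -> 0 <= c ->
  (forall n, 0 <= om n) -> om n @[n --> \oo] --> 0 ->
  (\forall n \near \oo, q' n <= k * q n + om n / b n + c * eps n / (v n)%:R) ->
  o_plus_bigO b v eps q -> o_plus_bigO b v eps q'.
Proof.
move=> k0 c0 om0 omc q'q [C [delta [C0 d0 dc qd]]].
exists (k * C + c), (fun n => k * delta n + om n); split.
- by rewrite addr_ge0// mulr_ge0.
- by move=> n; rewrite addr_ge0// mulr_ge0.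
- rewrite -[X in _ --> X](_ : k * 0 + 0 = 0); last by rewrite mulr0 addr0.
  by apply: cvgD => //; apply: cvgMr.
near=> n.
have H1 : q' n <= k * q n + om n / b n + c * eps n / (v n)%:R by near: n.
have H2 : k * q n <= k * (delta n / b n + C * eps n / (v n)%:R).
  by apply: ler_wpM2l => //; near: n.
by apply: (le_trans H1); rewrite !mulrDl; lra.
Unshelve. all: by end_near. Qed.

Theorem theorem1p2 (R : realType) (d : measure_display) (T : measurableType d)
    (P : probability T R) (S : nat -> {RV P >-> R}) (a b : nat -> R)
    (Q : probability R R) (G g : R -> R) (v : nat -> nat)
    (S_int : forall n, (1 <= n)%N -> forall w, S n w \is a Num.int)
    (b_gt0 : forall n, (1 <= n)%N -> 0 < b n)
    (b_infty : b n @[n --> \oo] --> +oo)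
    (S_weak : weak_cvg
      (fun n => distribution P (normalized (S n) (a n) (b n))) Q)
    (G_df : forall x, (G x)%:E = Q `]-oo, x]%classic)
    (g_density : has_density Q g)
    (g_unif : unif_continuous g)
    (v_gt0 : forall n, (1 <= n)%N -> (0 < v n)%N)
    (v_littleo : (fun n => (v n)%:R : R) =o_\oo b) :
  let eps := fun n => unif_dist P (normalized (S n) (a n) (b n)) G in
  o_plus_bigO b v eps (fun n =>
    sup [set q : R | exists m k : int,
           `|m - k| <= (v n)%:Z /\ q = `|pmf (S n) m%:~R - pmf (S n) k%:~R|])
  <->
  o_plus_bigO b v eps (fun n =>
    sup [set `|pmf (S n) m%:~R - (b n)^-1 * g ((m%:~R - a n) / b n)|
         | m in [set: int]]).
Proof.
move=> eps.
have [M gM] := unif_continuous_density_bounded G_df g_density g_unif.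
pose om n := modulus g ((v n)%:R / b n).
have om0 n : 0 <= om n by exact: modulus_ge0.
have omc : om n @[n --> \oo] --> 0.
  apply: modulus_cvg0 => //; apply/cvgr0Pnorm_le => e e0.
  move/eqoP : v_littleo => /(_ e e0) vb.
  near=> n; have n1 : (1 <= n)%N by near: n; exists 1%N.
  have b0 := b_gt0 n n1.
  rewrite normrM normfV ler_pdivrMr ?normr_gt0 ?gt_eqF//.
  by near: n.
have gom n x y : `|x - y| <= (v n)%:R / b n -> `|g x - g y| <= om n.
  exact: le_modulus gM.
split.
- apply: (@o_plus_bigO_le _ _ _ _ _ _ om 1 2 ler01 (ler0n _ 2) om0 omc).
  near=> n; have n1 : (1 <= n)%N by near: n; exists 1%N.
  have b0 := b_gt0 n n1; have v0 := v_gt0 n n1.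
  have v0R : 0 < (v n)%:R :> R by rewrite ltr0n.
  rewrite mul1r; set A := (X in _ <= X + _ + _); apply: ge_sup.
    by eexists; exists 0.
  move=> _ [m _ <-].
  rewrite -(ler_pM2l v0R) -{1}(gtr0_norm v0R) -normrM.
  (* After multiplication by [v n], the window sum is inserted between
     [v n] copies of [pmf m] ([V]) and the density term ([W]). *)
  have W := @pmf_window_approx _ _ _ _ _ _ _ _ (a n) _ _ _ m (S_int n n1) G_df
    g_density b0 (gom n).
  have V : `|(v n)%:R * pmf (S n) m%:~R -
      \sum_(j < v n) pmf (S n) (m + j%:Z)%:~R| <= (v n)%:R * A.
    apply: dist_natmul_sum => j; apply: ub_le_sup.
      exists 1 => _ [i [l [_ ->]]].
      have := pmf_bounds (S n) i%:~R; have := pmf_bounds (S n) l%:~R.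
      by rewrite ler_norml; lra.
    exists m, (m + j%:Z); split => //.
    by rewrite opprD addNKr normrN ger0_norm// lez_nat; exact: ltnW.
  have -> : (v n)%:R * (A + om n / b n + 2 * eps n / (v n)%:R) =
     (v n)%:R * A + (2 * eps n + (v n)%:R / b n * om n).
     by field; rewrite !gt_eqF.
  apply: le_trans (lerD V W); apply: le_trans (ler_normD _ _).
  by rewrite le_eqVlt; apply/predU1P; left; congr `|_|; ring.
- apply: (@o_plus_bigO_le _ _ _ _ _ _ om 2 0 (ler0n _ 2) (lexx _) om0 omc).
  near=> n; have n1 : (1 <= n)%N by near: n; exists 1%N.
  have b0 := b_gt0 n n1.
  set B := (X in 2 * X); apply: ge_sup.
    by exists 0, 0, 0; rewrite !subrr !normr0.
  move=> _ [m [k [mk ->]]].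
  have HB i : `|pmf (S n) i%:~R - (b n)^-1 * g ((i%:~R - a n) / b n)| <= B.
    apply: ub_le_sup; last by exists i.
    exists (1 + (b n)^-1 * M) => _ [l _ <-].
    apply: le_trans (ler_normB _ _) _; apply: lerD.
      by have := pmf_bounds (S n) l%:~R; rewrite ler_norml; lra.
    by rewrite normrM gtr0_norm ?invr_gt0// ler_pM2l ?invr_gt0.
  have : `|(b n)^-1 * g ((m%:~R - a n) / b n) -
      (b n)^-1 * g ((k%:~R - a n) / b n)| <= om n / b n.
    rewrite -mulrBr normrM gtr0_norm ?invr_gt0// mulrC ler_pM2r ?invr_gt0//.
    apply: gom; rewrite -mulrBl normrM (gtr0_norm (x := (b n)^-1)) ?invr_gt0//.
    rewrite ler_pM2r ?invr_gt0// opprB addrA subrK -intrB -intr_norm.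
    by rewrite -[(v n)%:R]/((v n)%:Z%:~R) ler_int.
  have := HB m; have := HB k; rewrite mul0r mul0r addr0.
  by rewrite !ler_norml; lra.
Unshelve. all: by end_near. Qed.
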